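(* Let $f$ be the constraint function, with row index set $\mathcal{J}=\{1,\dots,r\}$, of the mixed-integer convex chance constrained program $$\min_{(\mathbf{x},\mathbf{y})\in\mathbf{V}} c^\top\mathbf{x}\quad\text{subject to}\quad \mathbb{P}[f(\mathbf{x},\mathbf{y},\mathbf{w})\le 0]\ge 1-\epsilon,$$ let $\rho$ be its support rank function, let $\nu$ be a computational cost metric, let $\beta\in(0,1/e)$, and let $P\le r$ be a given partition size. Define $\gamma:2^{\mathcal{J}}\to\mathbb{R}_{\ge0}$ by $$\gamma(\mathcal{A}):=\sqrt{\sigma(\mathcal{A})},\qquad \sigma(\mathcal{A}):=\Big(\ln\Big(\frac{2^bP}{\beta}\Big)+\rho(\mathcal{A})-1\Big)\nu(\mathcal{A}).$$ Then there exists a $\mu\in(0,1]$ such that the set function $\gamma$ is $\mu$-weakly submodular.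
   Context: Setting. $\mathbf{V}\subseteq\mathbb{R}^n\times\{0,1\}^b$ is compact and convex for fixed $\mathbf{y}$; $c\in\mathbb{R}^n$; $\epsilon\in(0,1)$; $\mathbf{w}$ is an uncertain parameter defined over a probability space $(\mathbf{W},\mathcal{F},\mathbb{P})$; $f:\mathbb{R}^n\times\{0,1\}^b\times\mathbf{W}\to\mathbb{R}^r$ has components $f_1,\dots,f_r$ and is convex in $\mathbf{x}$ for all $\mathbf{w}\in\mathbf{W}$ and all $\mathbf{y}\in\mathbf{Y}:=\{\mathbf{y}\in\{0,1\}^b:\exists\mathbf{x},\ (\mathbf{x},\mathbf{y})\in\mathbf{V}\}$. Support rank. Let $\mathcal{L}$ be the set of all linear subspaces of $\mathbb{R}^n$. For a function $g(\mathbf{x},\mathbf{y},\mathbf{w})$ let $F_g(\mathbf{x},\mathbf{y},\mathbf{w}):=\{\xi\in\mathbb{R}^n: g(\mathbf{x}+\xi,\mathbf{y},\mathbf{w})=g(\mathbf{x},\mathbf{y},\mathbf{w})\}$ and $\mathcal{L}_g:=\bigcap_{(\mathbf{x},\mathbf{y},\mathbf{w})\in\mathbf{V}\times\mathbf{W}}\{L\in\mathcal{L}: L\subseteq F_g(\mathbf{x},\mathbf{y},\mathbf{w})\}$. For $\mathcal{A}\subseteq\mathcal{J}$, $L_{\mathcal{A}}$ is the maximal (with respect to inclusion) element of $\mathcal{L}_g$ with $g=\max_{j\in\mathcal{A}}f_j$, and $\rho(\mathcal{A}):=n-\dim(L_{\mathcal{A}})$; by convention $\rho(\emptyset)=0$.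 Computational cost metric: a set function $\nu:2^{\mathcal{J}}\to\mathbb{R}_{\ge0}$ that is monotone, modular ($\nu(\mathcal{A}\cup\{j\})-\nu(\mathcal{A})=\nu(\mathcal{B}\cup\{j\})-\nu(\mathcal{B})$ for $\mathcal{A}\subseteq\mathcal{B}\subset\mathcal{J}$, $j\in\mathcal{J}\setminus\mathcal{B}$), and satisfies $\nu(\{j\})>0$ for all $j\in\mathcal{J}$. Monotone: $\gamma(\mathcal{A})\le\gamma(\mathcal{B})$ whenever $\mathcal{A}\subseteq\mathcal{B}$. A monotone set function $\gamma:2^{\mathcal{J}}\to\mathbb{R}_{\ge0}$ is $\mu$-weakly submodular, with $\mu\in(0,1]$, if for all $\mathcal{A},\mathcal{B}\subseteq\mathcal{J}$ with $\mathcal{A}\cap\mathcal{B}=\emptyset$: $\sum_{j\in\mathcal{B}}(\gamma(\mathcal{A}\cup\{j\})-\gamma(\mathcal{A}))\ge\mu\,(\gamma(\mathcal{A}\cup\mathcal{B})-\gamma(\mathcal{A}))$. *)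

(* Defs.v *)
From HB Require Import structures.
From mathcomp Require Import all_boot all_order all_algebra.
From mathcomp Require Import all_classical all_reals all_analysis.

Set Implicit Arguments.
Unset Strict Implicit.
Unset Printing Implicit Defensive.

Import Order.TTheory GRing.Theory Num.Theory.
Import numFieldNormedType.Exports.

Local Open Scope classical_set_scope.
Local Open Scope ring_scope.

(* Mixed-integer convex chance constrained programs
     min c^T x  over (x, y) in dom  subject to  Pr[f(x, y, w) <= 0] >= 1 - eps.
   The binary vectors {0,1}^b are the elements of 'rV[bool]_b, with the
   discrete topology. *)
Record miccp (R : realType) (d : measure_display) (W : measurableType d)
    (n b r : nat) := Miccp {
  dom : set ('rV[R]_n * 'rV[bool]_b);
  cost : 'rV[R]_n;
  risk : R;
  law : probability W R;
  constr : 'rV[R]_n -> 'rV[bool]_b -> W -> 'rV[R]_r;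
  dom_compact : compact dom;
  dom_convex : forall y, convex_set [set x | dom (x, y)];
  risk_range : 0 < risk < 1;
  (* convexity is on all of R^n, not merely on the slice of the domain at y *)
  constr_convex : forall (w : W) (y : 'rV[bool]_b) (j : 'I_r),
    (exists x, dom (x, y)) ->
    convex_function setT (fun x => constr x y w 0 j)
}.

Section program.
Context {R : realType} {d : measure_display} {W : measurableType d}.
Context {n b r : nat}.
Variable M : miccp R W n b r.

Definition objective (z : 'rV[R]_n * 'rV[bool]_b) : R :=
  \sum_i cost M 0 i * z.1 0 i.

(* The measurability conjunct makes the probability in the chance constraint
   that of an event; [law M] is a total function on all sets. *)
Definition chance_feasible : set ('rV[R]_n * 'rV[bool]_b) :=
  [set z | dom M z /\
    let E := [set w | forall j, constr M z.1 z.2 w 0 j <= 0] in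
    measurable E /\ ((1 - risk M)%:E <= law M E)%E].

Definition optimal (z : 'rV[R]_n * 'rV[bool]_b) : Prop :=
  chance_feasible z /\
  forall z', chance_feasible z' -> objective z <= objective z'.

Definition invariance (g : 'rV[R]_n -> 'rV[bool]_b -> W -> R)
    (x : 'rV[R]_n) (y : 'rV[bool]_b) (w : W) : set 'rV[R]_n :=
  [set xi | g (x + xi) y w = g x y w].

Definition invariant_subspaces (g : 'rV[R]_n -> 'rV[bool]_b -> W -> R) :
    set {vspace 'rV[R]_n} :=
  \bigcap_(p in dom M `*` [set: W])
    [set L : {vspace 'rV[R]_n} |
      [set` L] `<=` invariance g p.1.1 p.1.2 p.2].

Definition maximal_subspace (S : set {vspace 'rV[R]_n})
    (L : {vspace 'rV[R]_n}) : Prop :=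
  S L /\ forall L', S L' -> (L <= L')%VS -> L' = L.

(* max_{j in A} f_j; the value 0 for A = set0 is never used.  The maximum is
   seeded with an element of A, so it does not depend on the seed. *)
Definition max_constr (A : {set 'I_r}) (x : 'rV[R]_n) (y : 'rV[bool]_b)
    (w : W) : R :=
  if [pick j in A] is Some j0
  then \big[Num.max/constr M x y w 0 j0]_(j in A) constr M x y w 0 j
  else 0.

Lemma maximal_invariant_subspace_exists
    (g : 'rV[R]_n -> 'rV[bool]_b -> W -> R) :
  exists L, maximal_subspace (invariant_subspaces g) L.
Proof.
set S := invariant_subspaces g.
have S0 : S 0%VS.
  move=> p _ xi /=; rewrite memv0 => /eqP->.
  by rewrite /invariance /= addr0.
pose Q k := `[< exists L, S L /\ \dim L = k >].
have exQ : exists k, Q k by exists 0%N; apply/asboolP; exists 0%VS; rewrite dimv0.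
have bQ k : Q k -> (k <= \dim {:'rV[R]_n})%N.
  by move=> /asboolP[L [_ <-]]; apply: dimvS; exact: subvf.
case: (ex_maxnP exQ bQ) => k /asboolP[L [SL dL]] kmax.
exists L; split => // L' SL' LL'.
apply/eqP; rewrite eq_sym eqEdim LL' /= dL; apply: kmax.
by apply/asboolP; exists L'.
Qed.

Definition support_subspace (A : {set 'I_r}) : {vspace 'rV[R]_n} :=
  xget 0%VS (maximal_subspace (invariant_subspaces (max_constr A))).

Definition support_rank (A : {set 'I_r}) : nat :=
  if A == finset.set0 then 0%N else (n - \dim (support_subspace A))%N.

End program.

Definition monotone_setfun (R : realType) (r : nat) (g : {set 'I_r} -> R) :=
  forall A B : {set 'I_r}, A \subset B -> g A <= g B.

(* For [A \subset B] and [j \notin B], [B] is automatically a proper subset. *)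
Definition modular_setfun (R : realType) (r : nat) (g : {set 'I_r} -> R) :=
  forall (A B : {set 'I_r}) (j : 'I_r), A \subset B -> j \notin B ->
    g (j |: A)%SET - g A = g (j |: B)%SET - g B.

Definition cost_metric (R : realType) (r : nat) (nu : {set 'I_r} -> R) :=
  [/\ forall A, 0 <= nu A, monotone_setfun nu, modular_setfun nu
    & forall j, 0 < nu [set j]%SET].

Definition weakly_submodular (R : realType) (r : nat) (mu : R)
    (g : {set 'I_r} -> R) :=
  [/\ forall A, 0 <= g A, monotone_setfun g
    & forall A B : {set 'I_r}, (A :&: B)%SET = finset.set0 ->
        \sum_(j in B) (g (j |: A)%SET - g A) >= mu * (g (A :|: B)%SET - g A)].

Definition sigma_cost (R : realType) (d : measure_display)
    (W : measurableType d) (n b r : nat) (M : miccp R W n b r)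
    (nu : {set 'I_r} -> R) (beta : R) (P : nat) (A : {set 'I_r}) : R :=
  (ln (2 ^+ b * P%:R / beta) + (support_rank M A)%:R - 1) * nu A.

Definition gamma_cost (R : realType) (d : measure_display)
    (W : measurableType d) (n b r : nat) (M : miccp R W n b r)
    (nu : {set 'I_r} -> R) (beta : R) (P : nat) (A : {set 'I_r}) : R :=
  Num.sqrt (sigma_cost M nu beta P A).

(* Main.v *)
Require Import Defs.
From mathcomp Require Import all_boot all_order all_algebra.
From mathcomp Require Import all_classical all_reals all_analysis.
From mathcomp Require Import lra.

(** Since there are finitely many pairs of index sets, a monotone set function
[g] is weakly submodular for some positive ratio as soon as, for every pair
[A], [B], a positive joint gain [g (A :|: B) - g A] forces a positive marginal
gain [g (j |: A) - g A] for some [j] in [B]: the ratios of total marginal gain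
to positive joint gain are then positive, and the product of their truncations
at 1 works for all pairs at once ([weakly_submodular_flat_union]).  The property is
called [flat_union] below, because it says, for monotone [g], that the sets [A'] containing [A]
with [g A' = g A] are closed under union, as for the rank of a matroid.

The support rank has this property.  A convex function that is bounded above
on an affine subspace is constant there ([convex_bounded_const]).  As each
[f_j] lies below the maximum over [A], a subspace leaves the maximum invariant
iff it leaves every [f_j] with [j] in [A] invariant; the same principle shows
that the subspaces leaving [f_j] invariant are closed under sums.  Hence the
support subspace of [A] is not only maximal but the greatest subspace that
leaves all the [f_j], [j] in [A], invariant ([sub_support_subspace]), and rank
monotonicity follows.  If no [j] in [B] increases the rank of [A], the support
subspace of [A] is also that of every [j |: A], so it leaves all the rows in
[A :|: B] invariant and the rank of [A :|: B] is that of [A].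

The cost metric has the property by modularity.  The hypothesis
[beta < 1 / e] makes the logarithm larger than 1, so that [gamma ^ 2] is the
product of a positive and a nonnegative monotone function, both with the
property.  Such a product inherits it: where the cost is positive, a product
of nondecreasing positive factors is unchanged only if both factors are, and
where the cost is zero, adding any index makes the product positive
([sqrt_mul_flat_union]). *)

Set Implicit Arguments.
Unset Strict Implicit.
Unset Printing Implicit Defensive.

Import Order.TTheory GRing.Theory Num.Theory.

Local Open Scope ring_scope.

(** * Convex functions bounded above on affine subspaces *)

Section convex_lines.
Context {R : realType} {E : lmodType R}.
Variable h : E -> R.
Hypothesis convex_h : convex_function setT h.

Lemma convex_comb_le (t : R) (x y : E) : 0 <= t <= 1 ->
  h (t *: x + (1 - t) *: y) <= t * h x + (1 - t) * h y.
Proof.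
case/andP=> t0 t1.
exact: (@convex_h (Itv01 t0 t1) x y (in_setT _) (in_setT _)).
Qed.

(** If [e = h (x + u) - h x] were positive, convexity would force the value at
the [k]-th step to be at least [h x + k * e], eventually beyond [C]. *)
Lemma convex_bounded_ray (x u : E) (C : R) :
  (forall k : nat, h (x + k%:R *: u) <= C) -> h (x + u) <= h x.
Proof.
move=> hC; rewrite leNgt; apply/negP => hlt.
have e_gt0 : 0 < h (x + u) - h x by rewrite subr_gt0.
have C_ge : h x <= C by have := hC 0%N; rewrite scale0r addr0.
have q_ge0 : 0 <= (C - h x) / (h (x + u) - h x).
  by rewrite divr_ge0 ?subr_ge0// ltW.
have := archi_boundP q_ge0; set k := Num.bound _; rewrite ltr_pdivrMr// => kP.
have k_gt0 : 0 < k%:R :> R.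
  by rewrite -(pmulr_lgt0 _ e_gt0); apply: le_lt_trans kP; rewrite subr_ge0.
have k_ge1 : 1 <= k%:R :> R by rewrite ler1n -(ltr0n R).
have t01 : 0 <= (k%:R^-1 : R) <= 1 by rewrite invr_ge0 ltW//= invf_le1.
have := convex_comb_le (x + k%:R *: u) x t01.
have -> : k%:R^-1 *: (x + k%:R *: u) + (1 - k%:R^-1) *: x = x + u.
  rewrite scalerDr scalerA mulVf ?gt_eqF// scale1r addrAC -scalerDl.
  by rewrite subrKC scale1r.
move=> /(ler_wpM2l (ltW k_gt0)).
rewrite mulrDr !mulrA mulrBr mulr1 mulfV ?gt_eqF// mul1r => hk.
have := hC k; nra.
Qed.
End convex_lines.

(** The bound on rays applies from [x] in the direction [u], and back from
[x + u] in the direction [- u]. *)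
Lemma convex_bounded_const {R : realType} {E : vectType R} (h : E -> R)
    (L : {vspace E}) (x u : E) (C : R) :
  convex_function setT h ->
  (forall v, v \in L -> h (x + v) <= C) -> u \in L -> h (x + u) = h x.
Proof.
move=> convex_h hC uL; apply/eqP; rewrite eq_le; apply/andP; split.
  by apply: (convex_bounded_ray convex_h (C := C)) => k; exact/hC/memvZ.
have -> : h x = h ((x + u) + - u) by rewrite addrK.
apply: (convex_bounded_ray convex_h (C := C)) => k.
by rewrite -addrA; apply: hC; rewrite memvD// memvZ// memvN.
Qed.

(** * The support subspace and the support rank *)

Section support.
Context {R : realType} {d : measure_display} {W : measurableType d}.
Context {n b r : nat}.
Variable M : miccp R W n b r.
Implicit Types (A B : {set 'I_r}) (L : {vspace 'rV[R]_n}) (j : 'I_r).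

Definition constr_row j (x : 'rV[R]_n) (y : 'rV[bool]_b) (w : W) : R :=
  constr M x y w 0 j.

Lemma invariant_subspacesP (g : 'rV[R]_n -> 'rV[bool]_b -> W -> R) L :
  invariant_subspaces M g L <->
  forall x y w u, dom M (x, y) -> u \in L -> g (x + u) y w = g x y w.
Proof.
split=> [gL x y w u Vxy uL|gL [[x y] w] [/= Vxy _] u /= uL]; last exact: gL.
exact: (gL ((x, y), w)).
Qed.

Lemma convex_constr_row j x y w : dom M (x, y) ->
  convex_function setT (fun z : 'rV[R]_n => constr_row j z y w).
Proof. by move=> Vxy; apply: constr_convex; exists x. Qed.

Lemma constr_row_le_max A j x y w : j \in A ->
  constr_row j x y w <= max_constr M A x y w.
Proof.
move=> jA; rewrite /max_constr; case: pickP => [j0 _|/(_ j)]; last by rewrite jA.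
exact: (le_bigmax_cond _ (fun i => constr M x y w 0 i)).
Qed.

(** If the maximum is constant on [x + L], it bounds every row from above there,
and a bounded convex row is constant. *)
Lemma max_constr_invariantP A L :
  invariant_subspaces M (max_constr M A) L <->
  forall j, j \in A -> invariant_subspaces M (constr_row j) L.
Proof.
split=> [/invariant_subspacesP maxL j jA|rowL]; apply/invariant_subspacesP.
  move=> x y w u Vxy uL.
  apply: (convex_bounded_const (C := max_constr M A x y w)
    (convex_constr_row j w Vxy) _ uL) => v vL.
  by rewrite -(maxL x y w v Vxy vL) constr_row_le_max.
move=> x y w u Vxy uL.
have rowE j : j \in A -> constr M (x + u) y w 0 j = constr M x y w 0 j.
  by move=> jA; have /invariant_subspacesP := rowL j jA; apply.
rewrite /max_constr; case: pickP => // j0 j0A.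
by rewrite rowE//; exact: eq_bigr.
Qed.

Lemma constr_row_invariantS j L L' : (L <= L')%VS ->
  invariant_subspaces M (constr_row j) L' ->
  invariant_subspaces M (constr_row j) L.
Proof.
move=> /subvP LL' /invariant_subspacesP jL'.
by apply/invariant_subspacesP => x y w u Vxy /LL'; exact: jL'.
Qed.

(** For [v = v1 + v2] the point [x + v] is the midpoint of [x + 2 v1] and
[x + 2 v2], where the row has the same value as at [x]; so the row is bounded
above by that value on [x + (L1 + L2)].  Convexity is what makes this work:
[x + v1] may lie outside the domain, where invariance along [L2] is not
available. *)
Lemma constr_row_invariantD j L1 L2 :
  invariant_subspaces M (constr_row j) L1 ->
  invariant_subspaces M (constr_row j) L2 ->
  invariant_subspaces M (constr_row j) (L1 + L2)%VS.
Proof.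
move=> /invariant_subspacesP jL1 /invariant_subspacesP jL2.
apply/invariant_subspacesP => x y w u Vxy uL.
have convex_j := convex_constr_row j w Vxy.
apply: (convex_bounded_const (C := constr_row j x y w) convex_j _ uL) => v.
move=> /memv_addP[v1 v1L [v2 v2L ->]].
have half : 0 <= (2%:R^-1 : R) <= 1 by lra.
have := convex_comb_le convex_j (x + 2%:R *: v1) (x + 2%:R *: v2) half.
rewrite /= (jL1 x y w _ Vxy (memvZ _ v1L)) (jL2 x y w _ Vxy (memvZ _ v2L)).
have -> : 2%:R^-1 *: (x + 2%:R *: v1) + (1 - 2%:R^-1) *: (x + 2%:R *: v2)
    = x + (v1 + v2).
  have -> : 1 - 2%:R^-1 = 2%:R^-1 :> R by lra.
  rewrite !scalerDr !scalerA mulVf ?pnatr_eq0// !scale1r addrACA -scalerDl.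
  by rewrite (_ : 2%:R^-1 + 2%:R^-1 = 1) ?scale1r//; lra.
by rewrite -mulrDl subrKC mul1r.
Qed.

(** Maximality becomes being the greatest, as the sum of [L] and the support
subspace is again invariant. *)
Lemma sub_support_subspace A L :
  (L <= support_subspace M A)%VS <->
  forall j, j \in A -> invariant_subspaces M (constr_row j) L.
Proof.
have [/max_constr_invariantP suppA maxA] :
    maximal_subspace (invariant_subspaces M (max_constr M A))
      (support_subspace M A).
  exact: xgetPex (maximal_invariant_subspace_exists _ _).
split=> [LA j jA|rowL]; first exact: constr_row_invariantS LA (suppA j jA).
rewrite -(maxA (support_subspace M A + L)%VS) ?addvSr ?addvSl//.
by apply/max_constr_invariantP => j jA; apply: constr_row_invariantD; auto.
Qed.

Lemma support_subspaceS A B : A \subset B ->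
  (support_subspace M B <= support_subspace M A)%VS.
Proof.
move=> /fintype.subsetP AB; apply/sub_support_subspace => j /AB.
by move: j; apply/sub_support_subspace.
Qed.

Lemma dim_support_subspace A : (\dim (support_subspace M A) <= n)%N.
Proof.
by have := dimvS (subvf (support_subspace M A)); rewrite dimvf /dim/= mul1n.
Qed.

(** The convention that the empty set has rank 0 agrees with the general
formula: every subspace is invariant under an empty family of rows. *)
Lemma support_rankE A : support_rank M A = (n - \dim (support_subspace M A))%N.
Proof.
rewrite /support_rank; case: eqP => // ->.
suff /dimvS : (fullv <= support_subspace M finset.set0)%VS.
  by rewrite dimvf /dim/= mul1n -subn_eq0 => /eqP->.
by apply/sub_support_subspace => j; rewrite inE.
Qed.

Lemma support_rankS A B : A \subset B ->
  (support_rank M A <= support_rank M B)%N.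
Proof.
by move=> AB; rewrite !support_rankE leq_sub2l// dimvS// support_subspaceS.
Qed.

Lemma support_rank_flat_union A B :
  (forall j, j \in B -> support_rank M (j |: A) = support_rank M A) ->
  support_rank M (A :|: B) = support_rank M A.
Proof.
move=> rankB; apply/anti_leq; rewrite (support_rankS (finset.subsetUl A B)) andbT.
rewrite !support_rankE leq_sub2l// dimvS//.
apply/sub_support_subspace => i; rewrite inE => /orP[|iB].
  by move: i; apply/sub_support_subspace.
(* one space contains the other, and their codimensions agree *)
have <- : support_subspace M (i |: A) = support_subspace M A.
  apply/eqP; rewrite eqEdim support_subspaceS ?finset.subsetUr//=.
  have := rankB i iB; rewrite !support_rankE.
  have := dim_support_subspace A; have := dim_support_subspace (i |: A).
  by move=> h1 h2 /(congr1 (subn n)); rewrite !subKn// => ->.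
have /sub_support_subspace := subvv (support_subspace M (i |: A)).
by apply; rewrite finset.setU11.
Qed.
End support.

(** * Weak submodularity from the absence of hidden joint gains *)

Section flat_unions.
Context {R : realType} {r : nat}.
Implicit Types (g a v : {set 'I_r} -> R) (A B : {set 'I_r}).

Definition flat_union g := forall A B,
  (forall j, j \in B -> g (j |: A) = g A) -> g (A :|: B) = g A.

Lemma modular_flat_union g : modular_setfun g -> flat_union g.
Proof.
move=> gM A B; have [k] := ubnP #|B|; elim: k => // k IHk in B *.
have [->|[j jB]] := set_0Vmem B; first by rewrite finset.setU0.
rewrite (cardsD1 j) jB add1n ltnS => /IHk{}IHk gB.
have gD : g (A :|: B :\ j) = g A.
  by apply: IHk => i /setD1P[_]; exact: gB.
have -> : A :|: B = j |: (A :|: B :\ j) by rewrite finset.setUCA finset.setD1K.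
have [jA|jA] := boolP (j \in A).
  rewrite finset.setUA (_ : j |: A = A)//.
  by apply/finset.setUidPr; rewrite finset.sub1set.
have := gM A (A :|: B :\ j) j (finset.subsetUl _ _).
rewrite !inE eqxx (negbTE jA) gB// gD subrr => /(_ isT)/esym/eqP.
by rewrite subr_eq0 => /eqP.
Qed.

(** There are finitely many pairs [(A, B)], each with a positive admissible
ratio [m (A, B) <= 1]; their product is below each of them. *)
Lemma weakly_submodular_flat_union g :
  (forall A, 0 <= g A) -> monotone_setfun g -> flat_union g ->
  exists mu, 0 < mu <= 1 /\ weakly_submodular mu g.
Proof.
move=> g_ge0 gS g_flat.
pose gain A B := g (A :|: B) - g A.
pose marg A B := \sum_(j in B) (g (j |: A) - g A).
have step_ge0 A j : 0 <= g (j |: A) - g A.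
  by rewrite subr_ge0 gS// finset.subsetUr.
have gain_ge0 A B : 0 <= gain A B by rewrite subr_ge0 gS// finset.subsetUl.
have marg_ge0 A B : 0 <= marg A B by apply: sumr_ge0 => j _; exact: step_ge0.
pose m (p : {set 'I_r} * {set 'I_r}) : R :=
  if gain p.1 p.2 == 0 then 1 else Num.min 1 (marg p.1 p.2 / gain p.1 p.2).
have m_gt0 p : 0 < m p.
  rewrite /m; case: ifPn => // gain_neq0.
  rewrite lt_min ltr01/= divr_gt0// lt_def ?gain_neq0 ?gain_ge0// marg_ge0 andbT.
  apply: contra gain_neq0; rewrite psumr_eq0; last by move=> j _; exact: step_ge0.
  move=> /allP marg0; rewrite subr_eq0; apply/eqP/g_flat => j jB.
  by have := marg0 j (mem_index_enum j); rewrite jB subr_eq0 => /eqP.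
have m_le1 p : m p <= 1 by rewrite /m; case: ifP => // _; rewrite ge_min lexx.
have m_marg A B : m (A, B) * gain A B <= marg A B.
  rewrite /m/=; case: ifPn => [/eqP->|gain_neq0]; first by rewrite mulr0.
  by rewrite -ler_pdivlMr ?ge_min ?lexx ?orbT// lt_def gain_neq0 gain_ge0.
exists (\prod_p m p); split.
  by rewrite prodr_gt0//= prodr_ile1// => p _; rewrite ltW ?m_gt0 ?m_le1.
split=> // A B _; apply: le_trans (m_marg A B).
apply: ler_wpM2r; first exact: gain_ge0.
rewrite (bigD1 (A, B))//=; apply: ler_piMr; first exact/ltW.
by apply: prodr_ile1 => p _; rewrite ltW ?m_gt0 ?m_le1.
Qed.

(** Positivity of [v] on singletons and monotonicity handle the sets with
[v A = 0]: every step from such a set strictly increases the product, so [B]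
must be empty. *)
Lemma sqrt_mul_flat_union a v :
  (forall A, 0 < a A) -> monotone_setfun a -> flat_union a ->
  (forall A, 0 <= v A) -> monotone_setfun v -> flat_union v ->
  (forall j, 0 < v [set j]) ->
  monotone_setfun (fun A => Num.sqrt (a A * v A)) /\
  flat_union (fun A => Num.sqrt (a A * v A)).
Proof.
move=> a_gt0 aS a_flat v_ge0 vS v_flat v1_gt0.
have avS A B : A \subset B -> a A * v A <= a B * v B.
  by move=> AB; apply: ler_pM; rewrite ?(ltW (a_gt0 _)) ?v_ge0 ?aS ?vS.
split=> [A B AB|A B flatB]; first by rewrite ler_wsqrtr ?avS.
have avE j : j \in B -> a (j |: A) * v (j |: A) = a A * v A.
  by move=> /flatB /eqP; rewrite eqr_sqrt ?mulr_ge0 ?(ltW (a_gt0 _))// => /eqP.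
have v_gt0 j A' : j \in A' -> 0 < v A'.
  by move=> jA'; apply: lt_le_trans (v1_gt0 j) _; rewrite vS// finset.sub1set.
have [v0|v_neq0] := eqVneq (v A) 0.
  suff -> : B = finset.set0 by rewrite finset.setU0.
  apply/setP => j; rewrite inE; apply/negbTE/negP => jB.
  have := avE j jB; rewrite v0 mulr0 => /eqP.
  by rewrite mulf_eq0 !gt_eqF// (v_gt0 j)// finset.setU11.
have vA_gt0 : 0 < v A by rewrite lt_def v_neq0 v_ge0.
congr (Num.sqrt (_ * _)); [apply: a_flat|apply: v_flat] => j jB;
  have := avE j jB; have := aS A (j |: A)%SET (finset.subsetUr _ _);
  have := vS A (j |: A)%SET (finset.subsetUr _ _); have := a_gt0 A; nra.
Qed.
End flat_unions.

Theorem lemma2 (R : realType) (d : measure_display) (W : measurableType d)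
    (n b r : nat) (M : miccp R W n b r)
    (nu : {set 'I_r} -> R) (nuP : cost_metric nu)
    (beta : R) (beta_gt0 : 0 < beta) (beta_lt : beta < (expR 1)^-1)
    (P : nat) (P_gt0 : (0 < P)%N) (P_le : (P <= r)%N) :
  exists mu : R, (0 < mu <= 1) /\
    weakly_submodular mu (gamma_cost M nu beta P).
Proof.
case: nuP => nu_ge0 nuS nuM nu1_gt0.
have ln_gt1 : 1 < ln (2 ^+ b * P%:R / beta).
  have e_lt : expR 1 < beta^-1.
    by rewrite -[expR 1]invrK ltf_pV2 ?posrE ?invr_gt0 ?expR_gt0.
  have bP_ge1 : 1 <= 2 ^+ b * P%:R :> R.
    by rewrite -natrX -natrM ler1n muln_gt0 expn_gt0.
  have arg_gt : expR 1 < 2 ^+ b * P%:R / beta.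
    by apply: lt_le_trans e_lt _; rewrite ler_peMl// invr_ge0 ltW.
  by rewrite -ltr_expR lnK// posrE (lt_trans _ arg_gt)// expR_gt0.
pose a A : R := ln (2 ^+ b * P%:R / beta) + (support_rank M A)%:R - 1.
have a_gt0 A : 0 < a A by have := ler0n R (support_rank M A); rewrite /a; lra.
have aS : monotone_setfun a.
  by move=> A B AB; rewrite /a lerD2r lerD2l ler_nat support_rankS.
have a_flat : flat_union a.
  move=> A B aB; rewrite /a support_rank_flat_union// => j /aB.
  by move=> /addIr/addrI/eqP; rewrite eqr_nat => /eqP.
have [gammaS gamma_flat] := sqrt_mul_flat_union a_gt0 aS a_flat
  nu_ge0 nuS (modular_flat_union nuM) nu1_gt0.
by apply: weakly_submodular_flat_union => // A; exact: sqrtr_ge0.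
Qed.
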